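(* Let $c$ be a Coxeter element of $\widetilde S_n$ encoded by outer and inner points as in the context. For $j\in\mathbb Z$ write $y_j=\omega_c(\delta,\bar{\mathbf e}_j)$ and $x_j=\omega_c(\gamma_c,\bar{\mathbf e}_j)$ (these are the two coordinates of the projection of $\bar{\mathbf e}_j$ to the Coxeter plane in $V^*$ spanned by $\omega_c(\delta,\cdot)$ and $\omega_c(\gamma_c,\cdot)$). Then: (1)–(2) there are constants $y_{\mathrm{out}}<0<y_{\mathrm{inn}}$ such that $y_j=y_{\mathrm{out}}$ whenever $j\bmod n$ is outer and $y_j=y_{\mathrm{inn}}$ whenever $j\bmod n$ is inner (so the projected orbit lies on two parallel lines); (3) if $j<j'$ and $j\bmod n$, $j'\bmod n$ are both outer or both inner, then $x_{j'}>x_j$; (4) if $j<j'$ are consecutive among integers whose residues mod $n$ are outer, then $x_{j'}-x_j=-y_{\mathrm{out}}$; if $j<j'$ are consecutive among integers whose residues mod $n$ are inner, then $x_{j'}-x_j=y_{\mathrm{inn}}$; (5) $x_{j+n}-x_j=\omega_c(\gamma_c,\delta)$ for all $j$, independent of $j$.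
   Context: Fix $n\ge2$. $\widetilde S_n$ is the group of bijections $\pi$ of $\mathbb Z$ with $\pi(i+n)=\pi(i)+n$ and $\sum_{i=1}^n\pi(i)=\binom{n+1}2$, a Coxeter group with simple reflections $s_i$ ($i=1,\ldots,n$, indices mod $n$) where $s_i$ swaps $i+kn$ and $i+1+kn$ for all $k$. A Coxeter element $c$ is a product of $s_1,\dots,s_n$ in some order; $i\in\{1,\ldots,n\}$ is an outer point if $s_{i-1}$ precedes $s_i$ in $c$ and an inner point otherwise ($s_0=s_n$). In $\mathbb R^{n+1}$ with standard basis $\mathbf e_1,\ldots,\mathbf e_{n+1}$ put $\delta=\mathbf e_{n+1}-\mathbf e_1$ and define $\mathbf e_i$ for all $i\in\mathbb Z$ by $\mathbf e_{i+n}=\mathbf e_i+\delta$. A periodic permutation $\pi$ acts linearly by $\mathbf e_i\mapsto\mathbf e_{\pi(i)}$. Let $K$ be the symmetric bilinear form equal to the standard inner product on the span of $\mathbf e_1,\ldots,\mathbf e_n$ and with $K(\mathbf e_{n+1},x)=K(\mathbf e_1,x)$. Let $\alpha_i=\mathbf e_{i+1}-\mathbf e_i$ ($i$ mod $n$), $V$ their span (the vectors with coordinate sum $0$), and $a_{ij}=K(\alpha_i,\alpha_j)$. The skew-symmetric form $\omega_c$ on $V$ is defined by $\omega_c(\alpha_i,\alpha_j)=a_{ij}$ if $s_i$ follows $s_j$ in $c$, $0$ if $i=j$, and $-a_{ij}$ if $s_i$ precedes $s_j$ in $c$. $\gamma_c$ is the unique vector in the span of $\alpha_1,\ldots,\alpha_{n-1}$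 with $c\gamma_c=\gamma_c+\delta$. Since $\mathbb R^{n+1}=V\oplus\mathbb R(\mathbf e_1+\cdots+\mathbf e_n)$, let $\bar{\mathbf e}_j\in V$ denote the projection of $\mathbf e_j$ to $V$ along $\mathbf e_1+\cdots+\mathbf e_n$. *)

(* Defs.v *)
From HB Require Import structures.
From mathcomp Require Import all_boot all_order all_algebra.
From mathcomp Require Import reals zify ring.

Set Implicit Arguments.
Unset Strict Implicit.
Unset Printing Implicit Defensive.
Import Order.TTheory GRing.Theory Num.Theory.
Local Open Scope ring_scope.

Definition affine_perm (n : nat) (p : int -> int) : Prop :=
  [/\ bijective p,
      forall i : int, p (i + n%:Z) = p i + n%:Z
    & \sum_(1 <= i < n.+1) p i%:Z = 'C(n.+1, 2)%:Z].

(* Indices of simple reflections are integers read modulo n. *)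
Definition simple_refl (n : nat) (i : int) : int -> int := fun k =>
  if (k == i %[mod n%:Z])%Z then k + 1
  else if (k == i + 1 %[mod n%:Z])%Z then k - 1
  else k.

(* The product acts on the left of Z: the last letter is applied first. *)
Definition word_prod (n : nat) (w : seq nat) : int -> int :=
  foldr (fun (i : nat) (f : int -> int) => simple_refl n i%:Z \o f) id w.

(* c is the Coxeter element obtained by multiplying s_1, ..., s_n in the
   order w.  Membership in the affine group is automatic, see
   word_prod_affine. *)
Definition coxeter_element (n : nat) (w : seq nat) (c : int -> int) : Prop :=
  [/\ affine_perm n c, perm_eq w (iota 1 n) & c =1 word_prod n w].

Definition letter_pos (n : nat) (w : seq nat) (i : int) : nat :=
  find (fun l : nat => (l%:Z == i %[mod n%:Z])%Z) w.

Definition precedes (n : nat) (w : seq nat) (i j : int) : bool :=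
  (letter_pos n w i < letter_pos n w j)%N.

(* These depend only on j modulo n, so "j mod n is outer" is outer n w j. *)
Definition outer (n : nat) (w : seq nat) (j : int) : bool :=
  precedes n w (j - 1) j.

Definition inner (n : nat) (w : seq nat) (j : int) : bool := ~~ outer n w j.

(* j < j' are consecutive among the integers satisfying P. *)
Definition consecutive (P : int -> bool) (j j' : int) : Prop :=
  [/\ j < j', P j, P j' & forall k : int, j < k -> k < j' -> ~~ P k].

(* R^(n+1) is 'rV[R]_n.+1; the standard basis vector e_i (1 <= i <= n+1) is
   the one supported on column i - 1. *)
Definition delta (R : realType) (n : nat) : 'rV[R]_n.+1 :=
  delta_mx 0 ord_max - delta_mx 0 ord0.

(* j = (r + 1) + q n with 0 <= r < n, hence e_j = e_(r+1) + q delta; for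
   j = n + 1 this is the last standard basis vector, see evec_ord. *)
Definition evec (R : realType) (n : nat) (j : int) : 'rV[R]_n.+1 :=
  delta_mx 0 (inord `|((j - 1) %% n%:Z)%Z|%N)
  + (((j - 1) %/ n%:Z)%Z)%:~R *: delta R n.

Definition act (R : realType) (n : nat) (p : int -> int) (v : 'rV[R]_n.+1) :
    'rV[R]_n.+1 :=
  \sum_(i < n.+1) v 0 i *: evec R n (p i.+1%:Z).

(* On the standard basis, K(e_i, e_j) = 1 if i = j mod n, and 0 otherwise;
   columns are numbered 0, ..., n, so column n pairs like column 0. *)
Definition Kform (R : realType) (n : nat) (u v : 'rV[R]_n.+1) : R :=
  \sum_(i < n.+1) \sum_(j < n.+1)
    u 0 i * v 0 j * (i == j %[mod n])%:R.

Definition alpha (R : realType) (n : nat) (i : int) : 'rV[R]_n.+1 :=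
  evec R n (i + 1) - evec R n i.

Definition simple_roots (R : realType) (n : nat) : n.-tuple 'rV[R]_n.+1 :=
  [tuple alpha R n i.+1%:Z | i < n].

Definition Vspace (R : realType) (n : nat) : {vspace 'rV[R]_n.+1} :=
  <<simple_roots R n>>%VS.

Definition omega_simple (R : realType) (n : nat) (w : seq nat) (i j : int) : R :=
  let a := Kform (alpha R n i) (alpha R n j) in
  if (i == j %[mod n%:Z])%Z then 0
  else if precedes n w i j then - a else a.

(* The bilinear extension to V, of which the simple roots are a basis
   (simple_roots_free); its values outside V are irrelevant. *)
Definition omega (R : realType) (n : nat) (w : seq nat) (u v : 'rV[R]_n.+1) : R :=
  \sum_(i < n) \sum_(j < n)
    coord (simple_roots R n) i u * coord (simple_roots R n) j v
    * omega_simple R n w i.+1%:Z j.+1%:Z.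

Definition is_gamma (R : realType) (n : nat) (c : int -> int)
    (g : 'rV[R]_n.+1) : Prop :=
  g \in <<[seq alpha R n i%:Z | i <- iota 1 n.-1]>>%VS
  /\ act c g = g + delta R n.

Definition sum_e (R : realType) (n : nat) : 'rV[R]_n.+1 :=
  \sum_(1 <= i < n.+1) evec R n i%:Z.

Definition evec_bar (R : realType) (n : nat) (j : int) : 'rV[R]_n.+1 :=
  daddv_pi (Vspace R n) <[sum_e R n]>%VS (evec R n j).

Lemma evec_ord (R : realType) (n : nat) (i : 'I_n.+1) : (0 < n)%N ->
  evec R n i.+1%:Z = delta_mx 0 i.
Proof.
move=> n0; rewrite /evec.
rewrite intS addrAC subrr add0r.
have := ltn_ord i; rewrite ltnS leq_eqVlt => /orP[/eqP ein|ltin].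
  rewrite ein modzz divzz eqz_nat (gtn_eqF n0) scale1r.
  have -> : inord `|0%Z| = ord0 :> 'I_n.+1 by apply/val_inj; rewrite /= inordK.
  have -> : i = ord_max by apply/val_inj.
  by rewrite addrC subrK.
rewrite modz_small; last by rewrite lez_nat ltz_nat ltin.
rewrite divz_small; last by rewrite lez_nat ltz_nat ltin.
by rewrite scale0r addr0 absz_nat inord_val.
Qed.

Lemma alpha_ord (R : realType) (n : nat) (i : 'I_n) :
  alpha R n i.+1%:Z =
    delta_mx 0 (lift ord0 i) - delta_mx 0 (widen_ord (leqnSn n) i).
Proof.
have n0 : (0 < n)%N by case: n i => [[]|].
by rewrite -!evec_ord // /alpha lift0 [in RHS]intS [1 + _]addrC.
Qed.

Lemma simple_roots_free (R : realType) (n : nat) : free (simple_roots R n).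
Proof.
apply/freeP => k k0.
have H (j : 'I_n.+1) :
    \sum_(i < n) k i * ((j == lift ord0 i)%:R
                        - (j == widen_ord (leqnSn n) i)%:R) = 0.
  have /rowP/(_ j) := k0; rewrite summxE mxE => {2}<-; apply: eq_bigr => i _.
  by rewrite -tnth_nth tnth_mktuple alpha_ord !mxE !eqxx.
suff K m : forall i : 'I_n, (i < m)%N -> k i = 0 by move=> i; exact: (K i.+1).
elim: m => // m IH i; rewrite ltnS leq_eqVlt => /orP[/eqP im|]; last exact: IH.
have := H (widen_ord (leqnSn n) i).
rewrite (bigD1 i) //= eqxx big1 ?addr0 => [|l li].
  rewrite -val_eqE /= /bump /= add1n (ltn_eqF (ltnSn _)) sub0r mulrN1.
  by move/eqP; rewrite oppr_eq0 => /eqP.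
rewrite -!val_eqE /= /bump /= add1n.
have -> : (i == l :> nat) = false by apply/negbTE; rewrite eq_sym.
rewrite subr0; case: eqP => [il|_]; last by rewrite mulr0.
by rewrite IH ?mul0r // -im il.
Qed.

Lemma omega_simple_roots (R : realType) (n : nat) (w : seq nat) (i j : 'I_n) :
  omega w (alpha R n i.+1%:Z) (alpha R n j.+1%:Z) =
    omega_simple R n w i.+1%:Z j.+1%:Z.
Proof.
have E (l m : 'I_n) :
    coord (simple_roots R n) l (alpha R n m.+1%:Z) = (l == m)%:R.
  rewrite -(tnth_mktuple (fun i : 'I_n => alpha R n i.+1%:Z) m) (tnth_nth 0).
  by rewrite (coord_free _ _ (simple_roots_free R n)) // eq_sym.
rewrite /omega (bigD1 i) //= [X in _ + X]big1 => [|l /negbTE li]; last first.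
  by apply: big1 => m _; rewrite E li !mul0r.
rewrite (bigD1 j) //= [X in _ + X + _]big1 => [|l /negbTE lj]; last first.
  by rewrite (E l j) lj mulr0 mul0r.
by rewrite !E !eqxx !mul1r !addr0.
Qed.

Lemma affine_perm_comp (n : nat) (p q : int -> int) : (0 < n)%N ->
  affine_perm n p -> affine_perm n q -> affine_perm n (p \o q).
Proof.
case: n => // n _ [bp Pp Sp] [bq Pq Sq]; split.
- exact: bij_comp.
- by move=> i /=; rewrite Pq Pp.
have per (r : int -> int) (l i : int) :
    (forall i : int, r (i + n.+1%:Z) = r i + n.+1%:Z) ->
    r (i + l * n.+1%:Z) = r i + l * n.+1%:Z.
  move=> Pr; elim/int_rec: l => [|l IH|l IH]; first by rewrite mul0r !addr0.
    have E k : k + l.+1%:Z * n.+1%:Z = k + l%:Z * n.+1%:Z + n.+1%:Z.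
      by rewrite (intS l); ring.
    by rewrite !E Pr IH.
  apply: (addIr n.+1%:Z); rewrite -Pr.
  have E k : k + - l.+1%:Z * n.+1%:Z + n.+1%:Z = k + - l%:Z * n.+1%:Z.
    by rewrite (intS l); ring.
  by rewrite !E.
pose res (k : int) : 'I_n.+1 := inord `|((k - 1) %% n.+1%:Z)%Z|%N.
have resE k : exists l : int, k = (res k).+1%:Z + l * n.+1%:Z.
  exists ((k - 1) %/ n.+1%:Z)%Z.
  have b0 : 0 <= ((k - 1) %% n.+1%:Z)%Z by rewrite modz_ge0.
  have b1 : ((k - 1) %% n.+1%:Z)%Z < n.+1%:Z by rewrite ltz_pmod.
  have e := divz_eq (k - 1) n.+1%:Z.
  by rewrite /res inordK; lia.
have fE k : p k - k = p (res k).+1%:Z - (res k).+1%:Z.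
  by have [l {1 2}->] := resE k; rewrite per //; lia.
have inj : injective (fun i : 'I_n.+1 => res (q i.+1%:Z)).
  move=> i j eij; have [l ei] := resE (q i.+1%:Z).
  have [l' ej] := resE (q j.+1%:Z).
  have /(bij_inj bq) e : q i.+1%:Z = q (j.+1%:Z + (l - l') * n.+1%:Z).
    by rewrite per // ei ej eij; lia.
  have li := ltn_ord i; have lj := ltn_ord j.
  apply/val_inj; move: e; rewrite -[val i]/(i : nat) -[val j]/(j : nat).
  by have : l - l' = 0 \/ l - l' <= -1 \/ l - l' >= 1; [lia|nia].
have sumE (f : int -> int) :
    \sum_(1 <= i < n.+2) f i%:Z = \sum_(i < n.+1) f i.+1%:Z.
  by rewrite big_add1 big_mkord.
have T : 'C(n.+2, 2)%:Z = \sum_(1 <= i < n.+2) i%:Z.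
  by rewrite -bin2_sum (big_morph Posz PoszD (erefl _)) big_ltn // add0r.
have D : \sum_(i < n.+1) (p (q i.+1%:Z) - q i.+1%:Z)
         = \sum_(i < n.+1) (p i.+1%:Z - i.+1%:Z).
  rewrite [RHS](reindex_inj inj) /=.
  by apply: eq_bigr => i _; rewrite fE.
move: D; rewrite !sumrB -(sumE p) -(sumE q) -(sumE id) -(sumE (p \o q)).
by rewrite Sp Sq -T subrr => /eqP; rewrite subr_eq0 => /eqP.
Qed.

Lemma simple_refl_affine (n : nat) (i : int) : (1 < n)%N ->
  affine_perm n (simple_refl n i).
Proof.
move=> n1.
have dE (a b : int) : (a == b %[mod n%:Z])%Z = (n%:Z %| a - b)%Z.
  by rewrite eqz_mod_dvd.
have d1 (a : int) : (n%:Z %| a)%Z -> (n%:Z %| a + 1)%Z = false.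
  by move=> da; rewrite rpredDl ?dvdz1 ?absz_nat ?gtn_eqF //.
have invol : involutive (simple_refl n i).
  move=> k; rewrite [simple_refl n i k]/simple_refl !dE.
  case: ifP => [k1|k1]; last case: ifP => [k2|k2]; rewrite /simple_refl !dE.
  - have -> : k + 1 - i = k - i + 1 by ring.
    have -> : k + 1 - (i + 1) = k - i by ring.
    by rewrite d1 // k1 addrK.
  - have -> : k - 1 - i = k - (i + 1) by ring.
    by rewrite k2 subrK.
  - by rewrite k1 k2.
have per k : simple_refl n i (k + n%:Z) = simple_refl n i k + n%:Z.
  rewrite /simple_refl !modzDr.
  by do 2?[case: ifP => _]; rewrite // addrAC.
split => //; first exact: inv_bij.
case: n n1 dE d1 invol per => [//|n] n1 dE d1 invol per.
have -> : 'C(n.+2, 2)%:Z = \sum_(1 <= k < n.+2) k%:Z.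
  by rewrite -bin2_sum (big_morph Posz PoszD (erefl _)) big_ltn // add0r.
pose N := n.+1%:Z.
pose b (a k : int) : int := (k == a %[mod N])%Z%:R.
have bE k : simple_refl n.+1 i k = k + b i k - b (i + 1) k.
  rewrite /simple_refl /b -/N !dE.
  case k1: (N %| k - i)%Z; case k2: (N %| k - (i + 1))%Z.
  - have := d1 _ k2; have -> : k - (i + 1) + 1 = k - i by ring.
    by rewrite k1.
  - by rewrite subr0.
  - by rewrite addr0.
  - by rewrite addr0 subr0.
under eq_bigr => k _ do rewrite bE.
rewrite sumrB big_split /= -addrA -[RHS]addr0; congr (_ + _); apply/eqP.
have bS a (k : nat) : b (a + 1) k.+1%:Z = b a k%:Z.
  by rewrite /b !dE intS; have -> : 1 + k%:Z - (a + 1) = k%:Z - a by ring.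
rewrite subr_eq0 !big_add1 /=.
under [X in _ == X]eq_bigr => k _ do rewrite bS.
rewrite big_nat_recr //= [X in _ == X]big_nat_recl //.
rewrite addrC (inj_eq (addIr _)); apply/eqP.
by rewrite /b -[n.+1%:Z]/N -{1}[N]add0r modzDr.
Qed.

Lemma word_prod_affine (n : nat) (w : seq nat) : (1 < n)%N ->
  affine_perm n (word_prod n w).
Proof.
move=> n1; elim: w => [|i w IH] /=.
  split=> //; first by exists id.
  by rewrite -bin2_sum (big_morph Posz PoszD (erefl _)) [in RHS]big_ltn // add0r.
apply: affine_perm_comp => //; [exact: ltnW|exact: simple_refl_affine].
Qed.

(* Main.v *)
Require Import Defs.
From HB Require Import structures.
From mathcomp Require Import all_boot all_order all_algebra.
From mathcomp Require Import reals.
From mathcomp Require Import zify ring lra.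

Set Implicit Arguments.
Unset Strict Implicit.
Unset Printing Implicit Defensive.
Import Order.TTheory GRing.Theory Num.Theory.
Local Open Scope ring_scope.

(* Write s_i for the reflection u |-> u - K(alpha_i, u) alpha_i.  Moving the
   last letter l of a word to the front reverses the order of l relative to the
   other letters only, which gives
   omega_(l w)(s_l u, s_l v) = omega_(w l)(u, v); after a full rotation,
   omega_c(c u, c v) = omega_c(u, v).  Together with c gamma = gamma + delta
   this yields x_(c(j)) = x_j - y_(c(j)).  Now c maps each outer integer to the
   next outer one, and each inner integer to the previous inner one.
   Finally omega_c(delta, alpha_j) = eps_j - eps_(j+1), where eps is 1 on outer
   and -1 on inner integers, so y_j + eps_j is a constant C; the projections of
   e_1, ..., e_n sum to 0, so C is the mean of eps and -1 < C < 1. *)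

(** * Integers modulo [n] *)

Lemma residueP (n : nat) (j : int) : (0 < n)%N ->
  exists (i : 'I_n) (l : int), j = i.+1%:Z + l * n%:Z.
Proof.
move=> n0; have b0 : 0 <= ((j - 1) %% n%:Z)%Z by rewrite modz_ge0; lia.
have b1 : ((j - 1) %% n%:Z)%Z < n%:Z by rewrite ltz_pmod; lia.
have e := divz_eq (j - 1) n%:Z.
have lt : (`|((j - 1) %% n%:Z)%Z| < n)%N by lia.
by exists (Ordinal lt), ((j - 1) %/ n%:Z)%Z => /=; lia.
Qed.

Lemma eqz_mod_residue (n : nat) (i k : 'I_n) (l : int) :
  (i.+1%:Z == k.+1%:Z + l * n%:Z %[mod n%:Z])%Z = (i == k).
Proof.
rewrite addrC modzMDl -val_eqE /=.
have li := ltn_ord i; have lk := ltn_ord k.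
rewrite -addn1 -[k.+1]addn1 !PoszD eqz_modDr !modz_small //; lia.
Qed.

Lemma eqz_modP (n : nat) (i j : int) :
  reflect (exists l : int, i = j + l * n%:Z) (i == j %[mod n%:Z])%Z.
Proof.
rewrite eqz_mod_dvd; apply: (iffP dvdzP) => -[l e]; exists l; lia.
Qed.

Lemma eqz_modS (n : nat) (i : int) : (1 < n)%N ->
  (i + 1 == i %[mod n%:Z])%Z = false.
Proof.
move=> n1; rewrite eqz_mod_dvd addrC addKr; apply/negbTE.
by rewrite dvdz1 absz_nat; lia.
Qed.

Lemma eqz_modSS (n : nat) (i j : int) :
  (i + 1 == j + 1 %[mod n%:Z])%Z = (i == j %[mod n%:Z])%Z.
Proof. exact: eqz_modDr. Qed.

(** * Order of the letters in a word, and the motion of outer integers *)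

Section Word.

Variables (n : nat) (w : seq nat).
Hypotheses (n2 : (1 < n)%N) (wP : perm_eq w (iota 1 n)).

Definition letter_mod (k : int) : pred nat :=
  fun l => (l%:Z == k %[mod n%:Z])%Z.

Lemma count_letter_mod (k : int) : count (letter_mod k) w = 1%N.
Proof.
rewrite (permP wP); have [i [l ->]] := residueP k (ltnW n2).
rewrite -[iota 1 n]/(iota (1 + 0) n) iotaDl count_map -val_enum_ord count_map.
rewrite (@eq_count _ _ (pred1 i)) => [|j]; last first.
  by rewrite /= /letter_mod add1n eqz_mod_residue.
by rewrite count_uniq_mem ?enum_uniq // mem_enum.
Qed.

Lemma has_letter_mod (k : int) : has (letter_mod k) w.
Proof. by rewrite has_count count_letter_mod. Qed.

Lemma eq_letter_mod (i j : int) :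
  (i == j %[mod n%:Z])%Z -> letter_mod i =1 letter_mod j.
Proof. by move=> /eqP e k; rewrite /letter_mod e. Qed.

Lemma eq_letter_pos (i j : int) :
  (i == j %[mod n%:Z])%Z -> letter_pos n w i = letter_pos n w j.
Proof. by move=> e; apply: eq_find; apply: eq_letter_mod. Qed.

(** Every residue occurs in [w], so [find] returns a true position; the letter found there is
    congruent to both indices. *)
Lemma letter_pos_inj (i j : int) :
  letter_pos n w i = letter_pos n w j -> (i == j %[mod n%:Z])%Z.
Proof.
move=> e; have /(nth_find 0%N) := has_letter_mod i.
have /(nth_find 0%N) := has_letter_mod j.
rewrite -[find _ _]/(letter_pos n w j) -[find _ _]/(letter_pos n w i) e.
by rewrite /letter_mod => /eqP -> /eqP ->.
Qed.

Lemma precedesC (i j : int) : (i == j %[mod n%:Z])%Z = false ->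
  precedes n w j i = ~~ precedes n w i j.
Proof.
move=> ij; rewrite /precedes -leqNgt [in RHS]leq_eqVlt.
by case: eqP => //= e; have := letter_pos_inj e; rewrite eq_sym ij.
Qed.

Lemma eq_outer (i j : int) :
  (i == j %[mod n%:Z])%Z -> outer n w i = outer n w j.
Proof.
move=> e; rewrite /outer /precedes (eq_letter_pos e).
by rewrite (@eq_letter_pos (i - 1) (j - 1)) // eqz_modDr.
Qed.

Lemma letter_posE (a b : seq nat) (l : nat) : w = a ++ l :: b ->
  letter_pos n w l%:Z = size a.
Proof.
move=> e; have := count_letter_mod l%:Z; rewrite e count_cat /=.
rewrite {2}/letter_mod eqxx /letter_pos find_cat.
by rewrite -[has _ a]/(has (letter_mod l) a) has_count /= eqxx;
  case: ifP => //; lia.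
Qed.

Lemma suffix_once (a b : seq nat) (l : nat) (k : int) : w = a ++ l :: b ->
  letter_mod k l -> has (letter_mod k) b = false.
Proof.
move=> e kl; have := count_letter_mod k; rewrite e count_cat /= kl has_count.
by lia.
Qed.

(** The residue of [k] occurs only once in [w]; if it occurs in [b], it cannot occur in [a] or at
    [l]. *)
Lemma precedes_suffix (a b : seq nat) (l : nat) (i k : int) :
  w = a ++ l :: b -> letter_mod i l -> has (letter_mod k) b -> precedes n w i k.
Proof.
move=> e li kb; rewrite /precedes -(eq_letter_pos li) (letter_posE e).
have := count_letter_mod k; rewrite {1}e count_cat /=.
move: (kb); rewrite has_count => kb1 ct.
rewrite e /letter_pos find_cat -[has _ a]/(has (letter_mod k) a).
have /negbTE -> : ~~ has (letter_mod k) a by rewrite has_count; lia.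
by rewrite /= -[_ == _]/(letter_mod k l); case: ifP => kl; lia.
Qed.

Lemma precedes_prefix (a b : seq nat) (l : nat) (i k : int) :
  w = a ++ l :: b -> letter_mod i l -> has (letter_mod k) (l :: b) = false ->
  precedes n w k i.
Proof.
move=> e li kb; rewrite /precedes -(eq_letter_pos li) (letter_posE e).
have := has_letter_mod k; rewrite e has_cat kb orbF => ka.
by rewrite /letter_pos find_cat -[has _ a]/(has (letter_mod k) a) ka -has_find.
Qed.

(** The first letter [l] of [w] is a witness: no letter precedes it, and it precedes [l + 1]. *)
Lemma exists_inner_outer : exists j : int, inner n w j /\ outer n w (j + 1).
Proof.
have: size w = n by rewrite (perm_size wP) size_iota.
case e: w => [|l b] => [/= n0|_]; first by move: n2; rewrite -n0.
have l0 : letter_pos n w l%:Z = 0%N by rewrite (@letter_posE [::] b).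
exists l%:Z; rewrite -e /inner /outer /precedes addrK l0; split=> //.
rewrite lt0n; apply/eqP => e1.
by have := @letter_pos_inj (l%:Z + 1) l%:Z;
  rewrite e1 l0 eqz_modS // => /(_ erefl).
Qed.

(* Following j through the word from right to left: it climbs through
   j, ..., p, the last letter used being s_(p-1), and s_p is still to come. *)
Lemma word_prod_outer (j j' : int) :
  consecutive (outer n w) j j' -> word_prod n w j = j'.
Proof.
move=> [jj' oj oj' bet].
suff H a b : w = a ++ b ->
    let p := word_prod n b j in
    [/\ j <= p <= j', p < j' -> has (letter_mod p) b = false
      & forall k : int, j <= k -> k < p -> has (letter_mod k) b].
  have [/andP[_ pj'] pN _] := H [::] w erefl.
  move: pj'; rewrite le_eqVlt => /orP[/eqP//|/pN].
  by rewrite has_letter_mod.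
elim: b a => [|l b IH] a e /=.
  by split=> // [|k jk kj]; [rewrite lexx ltW | lia].
have := IH (rcons a l); rewrite cat_rcons => /(_ e) /=.
move: (word_prod n b j) => p [/andP[jp pj'] pN pY].
rewrite /simple_refl.
case: ifP => [lp|lp].
  have lp' : letter_mod p l by rewrite /letter_mod eq_sym.
  (* If [p = j'], the letter [p - 1] would already have been used in [b], so [p] would precede
     [p - 1] in [w], against [j'] being outer. *)
  have pj : p < j'.
    rewrite lt_neqAle pj' andbT; apply/eqP => pe.
    have := @precedes_suffix a b l p (p - 1) e lp'.
    rewrite pY //; try lia; move=> /(_ isT).
    rewrite precedesC; first by move: oj'; rewrite /outer -pe => ->.
    by rewrite -{2}[p](subrK 1) eq_sym eqz_modS.
  split; first lia.
    (* If the letter [p + 1] were in [b], then [p] would precede it and [p + 1] would be an outer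
       integer strictly between [j] and [j']. *)
    move=> p1j'; apply/negbTE/negP => /= /orP[lp1|hb].
      have := eqz_modS p n2.
      by rewrite -(eqP (lp1 : (_ == _ %[mod _])%Z)) (eqP lp') eqxx.
    have := bet (p + 1); rewrite /outer addrK.
    by rewrite (precedes_suffix e lp' hb) => h;
      suff : ~~ true by []; apply: h; lia.
  move=> k jk kp /=; case: (ltrP k p) => [/(pY _ jk) ->|pk].
    by rewrite orbT.
  by rewrite (_ : k = p) ?lp' //; lia.
(* A step down from [p] to [p - 1] never happens. For [j < p] the letter [p - 1] would occur twice
   in [w]. For [p = j] the letter [j] would lie to the left of [l], hence precede [j - 1], against
   [j] being outer. *)
case: ifP => [lp1|lp1].
  have lp' : letter_mod (p - 1) l.
    by rewrite /letter_mod eq_sym -eqz_modSS subrK.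
  have := suffix_once e lp'; move: jp; rewrite le_eqVlt => /orP[/eqP jp|jp].
    have jb : has (letter_mod j) (l :: b) = false.
      rewrite -jp /= in pN *; rewrite pN // orbF; apply/negbTE/negP => lj.
      have := eqz_modS (p - 1) n2.
      rewrite -(eqP (lp' : (_ == _ %[mod _])%Z)) subrK -jp.
      by rewrite -(eqP (lj : (_ == _ %[mod _])%Z)) eqxx.
    have := precedes_prefix e lp' jb; rewrite -jp precedesC.
      by move: oj; rewrite /outer => ->.
    by rewrite -{2}[j](subrK 1) eq_sym eqz_modS.
  by rewrite pY //; lia.
split; first lia.
  by move=> /pN /= ->; rewrite orbF /letter_mod eq_sym.
by move=> k jk kp /=; rewrite pY // orbT.
Qed.

End Word.

(** * Reversed words and the motion of inner integers *)

Lemma find_rev (T : Type) (a : pred T) (s : seq T) : count a s = 1%N ->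
  (find a (rev s) + find a s)%N = (size s).-1.
Proof.
elim: s => [//|x s IH] /=; rewrite rev_cons -cats1 find_cat has_rev size_rev /=.
case: (boolP (a x)) => ax /= cs.
  by rewrite has_count (_ : count a s = 0%N) /=; lia.
have c1 : count a s = 1%N by lia.
by rewrite has_count c1 /= addnS IH //; case: s c1 {IH cs}.
Qed.

(** Reversal sends position [p] to [n - 1 - p], so it inverts the order of the letters [j - 1] and
    [j]. *)
Lemma outer_rev (n : nat) (w : seq nat) (j : int) : (1 < n)%N ->
  perm_eq w (iota 1 n) -> outer n (rev w) j = inner n w j.
Proof.
move=> n2 wP; rewrite /inner /outer -(precedesC n2 wP); last first.
  by rewrite -{2}[j](subrK 1) eq_sym eqz_modS.
rewrite /precedes /letter_pos.
have F k := find_rev (count_letter_mod n2 wP k).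
have L k := has_letter_mod n2 wP k.
move: (F j) (F (j - 1)) (L j) (L (j - 1)); rewrite !has_find.
by rewrite /letter_mod; lia.
Qed.

Lemma simple_reflK (n : nat) (i : int) : (1 < n)%N ->
  involutive (simple_refl n i).
Proof.
move=> n2 k; rewrite [simple_refl n i k]/simple_refl.
case: ifP => [k1|k1]; last case: ifP => [k2|k2]; rewrite /simple_refl.
- by rewrite -(eqP k1) eqz_modS // eqz_modSS k1 addrK.
- by rewrite -eqz_modSS subrK k2.
- by rewrite k1 k2.
Qed.

Lemma word_prod_revK (n : nat) (w : seq nat) : (1 < n)%N ->
  cancel (word_prod n w) (word_prod n (rev w)).
Proof.
move=> n2; elim: w => [//|l w IH] k; rewrite rev_cons.
have cat a b t : word_prod n (a ++ b) t = word_prod n a (word_prod n b t).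
  by elim: a => //= x a ->.
by rewrite -cats1 cat /= simple_reflK.
Qed.

(** The reversed word represents the inverse permutation and exchanges outer with inner integers, so
    the outer case applies to [rev w]. *)
Lemma word_prod_inner (n : nat) (w : seq nat) (j j' : int) : (1 < n)%N ->
  perm_eq w (iota 1 n) -> consecutive (inner n w) j j' -> word_prod n w j' = j.
Proof.
move=> n2 wP [jj' ij ij' bet].
have wP' : perm_eq (rev w) (iota 1 n) by rewrite perm_rev.
rewrite -(@word_prod_outer n (rev w) n2 wP' j j').
  by rewrite -{1}[w]revK word_prod_revK.
by split; rewrite ?outer_rev // => k jk kj; rewrite outer_rev //; apply: bet.
Qed.

(** * Action on vectors, the form [K] and the reflections *)

Section Linear.

Variables (R : realType) (n : nat).
Hypothesis n2 : (1 < n)%N.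
Implicit Types (u v : 'rV[R]_n.+1) (i j k l : int) (w : seq nat).

Local Notation e := (evec R n).
Local Notation al := (alpha R n).
Local Notation de := (delta R n).
Local Notation K := (@Kform R n).
Local Notation congR i j := ((i == j %[mod n%:Z])%Z%:R : R).

Lemma evec_widen (i : 'I_n) : e i.+1%:Z = delta_mx 0 (widen_ord (leqnSn n) i).
Proof. by rewrite -(evec_ord R (widen_ord (leqnSn n) i) (ltnW n2)). Qed.

Lemma evec_shift j l : e (j + l * n%:Z) = e j + l%:~R *: de.
Proof.
have -> : j + l * n%:Z = l * n%:Z + j by rewrite addrC.
rewrite /evec -addrA modzMDl divzMDl; last lia.
by rewrite intrD scalerDl [l%:~R *: _ + _]addrC addrA.
Qed.

Lemma deltaE : de = e (1 + n%:Z) - e 1.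
Proof. by rewrite -[n%:Z]mul1r evec_shift scale1r addrC addKr. Qed.

Lemma alpha_shift j l : al (j + l * n%:Z) = al j.
Proof.
by rewrite /alpha (addrAC j) !evec_shift opprD addrACA subrr addr0.
Qed.

Lemma eq_alpha i j : (i == j %[mod n%:Z])%Z -> al i = al j.
Proof. by move=> /eqz_modP[l ->]; rewrite alpha_shift. Qed.

Lemma evec_ind (P : 'rV[R]_n.+1 -> Prop) :
  P 0 -> (forall a u v, P u -> P v -> P (a *: u + v)) -> (forall j, P (e j)) ->
  forall u, P u.
Proof.
move=> P0 PD Pe u; rewrite (row_sum_delta u).
elim/big_rec: _ => // i v _ Pv; apply: PD => //.
by rewrite -evec_ord // ltnW.
Qed.

Lemma act_linear (p : int -> int) : linear (@act R n p).
Proof.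
move=> a u v; rewrite /act scaler_sumr -big_split; apply: eq_bigr => i _.
by rewrite !mxE scalerDl scalerA.
Qed.

HB.instance Definition _ (p : int -> int) :=
  GRing.isLinear.Build R 'rV[R]_n.+1 'rV[R]_n.+1 *:%R
    (@act R n p) (act_linear p).

Lemma act_delta_mx (p : int -> int) (i : 'I_n.+1) :
  act p (delta_mx 0 i : 'rV[R]_n.+1) = e (p i.+1%:Z).
Proof.
rewrite /act (bigD1 i) //= big1 ?addr0 => [|k ki]; rewrite mxE eqxx /=.
  by rewrite eqxx scale1r.
by rewrite (negbTE ki) scale0r.
Qed.

Lemma periodicM (p : int -> int) : (forall i, p (i + n%:Z) = p i + n%:Z) ->
  forall i l, p (i + l * n%:Z) = p i + l * n%:Z.
Proof.
move=> Pp i; elim/int_rect => [|l IH|l IH]; first by rewrite mul0r !addr0.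
  have E k : k + l.+1%:Z * n%:Z = k + l%:Z * n%:Z + n%:Z.
    by rewrite (intS l); ring.
  by rewrite !E Pp IH.
have E k : k + - l.+1%:Z * n%:Z + n%:Z = k + - l%:Z * n%:Z.
  by rewrite (intS l); ring.
by apply: (addIr n%:Z); rewrite -Pp !E.
Qed.

(** [act] prescribes the images of the standard basis vectors only. Periodicity of [p] makes [act p]
    fix delta, which carries the formula to every integer index. *)
Lemma act_evec (p : int -> int) j : (forall i, p (i + n%:Z) = p i + n%:Z) ->
  act p (e j) = e (p j).
Proof.
move=> Pp; have [i [l ->]] := residueP j (ltnW n2).
rewrite (periodicM Pp) !evec_shift linearD linearZ /=.
have -> : act p de = de.
  rewrite linearB /= !act_delta_mx /= intS Pp.
  by have := evec_shift (p 1) 1; rewrite mul1r => ->;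
    rewrite scale1r addrC addKr.
by rewrite evec_widen act_delta_mx.
Qed.

Lemma act_comp (p q : int -> int) u : (forall i, p (i + n%:Z) = p i + n%:Z) ->
  act (p \o q) u = act p (act q u).
Proof.
move=> Pp; rewrite [act q u]/act linear_sum; apply: eq_bigr => i _.
by rewrite linearZ /= act_evec.
Qed.

Lemma KformC u v : K u v = K v u.
Proof.
rewrite /Kform exchange_big; apply: eq_bigr => i _; apply: eq_bigr => j _.
by rewrite eq_sym [u 0 j * _]mulrC.
Qed.

Lemma Kform_linear u : linear (K u : 'rV[R]_n.+1 -> R^o).
Proof.
move=> a v t; rewrite /Kform scaler_sumr -big_split; apply: eq_bigr => i _.
rewrite scaler_sumr -big_split; apply: eq_bigr => j _.
by rewrite !mxE /GRing.scale /=; ring.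
Qed.

HB.instance Definition _ u :=
  GRing.isLinear.Build R 'rV[R]_n.+1 R^o *:%R (K u) (Kform_linear u).

Lemma Kform_delta_mx u (b : 'I_n.+1) :
  K u (delta_mx 0 b) = \sum_(i < n.+1) u 0 i * (i == b %[mod n])%N%:R.
Proof.
apply: eq_bigr => i _; rewrite (bigD1 b) //= big1 ?addr0 => [|j jb].
  by rewrite mxE !eqxx mulr1.
by rewrite mxE (negbTE jb) mulr0 mul0r.
Qed.

(** The first and last basis vectors pair alike with everything, so delta is in the radical of [K];
    hence [K] sees indices only modulo [n]. *)
Lemma Kform_delta u : K u de = 0.
Proof.
by rewrite linearB /= !Kform_delta_mx /= modnn mod0n subrr.
Qed.

Lemma Kform_evec i j : K (e i) (e j) = congR i j.
Proof.
have [i0 [l ->]] := residueP i (ltnW n2).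
have [j0 [m ->]] := residueP j (ltnW n2).
rewrite [in RHS]addrC modzMDl eqz_mod_residue.
rewrite !evec_shift linearD linearZ /= Kform_delta scaler0 addr0.
rewrite KformC linearD linearZ /= Kform_delta scaler0 addr0.
rewrite !evec_widen Kform_delta_mx (bigD1 (widen_ord (leqnSn n) j0)) //=.
rewrite big1 => [|k kj]; last by rewrite mxE (negbTE kj) andbF mul0r.
by rewrite mxE !eqxx mul1r addr0 !modn_small // eq_sym.
Qed.

Lemma Kform_alpha_evec i j : K (al i) (e j) = congR j (i + 1) - congR j i.
Proof.
rewrite KformC /alpha linearB /= !Kform_evec //.
Qed.

Definition refl (i : int) u : 'rV[R]_n.+1 := u - K (al i) u *: al i.

Lemma refl_linear i : linear (refl i).
Proof.
move=> a u v; rewrite /refl; move: (al i) => x.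
have -> : K x (a *: u + v) = a * K x u + K x v by rewrite linearP.
by rewrite scalerDl scalerBr scalerA opprD addrACA.
Qed.

HB.instance Definition _ i :=
  GRing.isLinear.Build R 'rV[R]_n.+1 'rV[R]_n.+1 *:%R (refl i) (refl_linear i).

(** It is enough to compare on [e j]: there [K (al i) (e j)] is -1, 1 or 0 according to whether [j]
    is congruent to [i], to [i + 1], or to neither. *)
Lemma act_simple_refl i u : act (simple_refl n i) u = refl i u.
Proof.
elim/evec_ind: u => [|a u v IHu IHv|j]; first by rewrite !linear0.
  by rewrite !linearP /= IHu IHv.
have [_ Pp _] := simple_refl_affine i n2.
rewrite act_evec // /refl Kform_alpha_evec /simple_refl.
case: ifP => [ji|ji].
  rewrite (eqP ji) eq_sym eqz_modS // sub0r scaleN1r opprK.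
  by rewrite -(eq_alpha ji) /alpha [RHS]addrC subrK.
case: ifP => [ji1|ji1]; last by rewrite subrr scale0r subr0.
rewrite subr0 scale1r; have -> : al i = al (j - 1).
  by apply: eq_alpha; rewrite eq_sym -eqz_modSS subrK.
by rewrite /alpha subrK opprB [RHS]addrC subrK.
Qed.

Lemma act_word w u :
  act (word_prod n w) u = foldr (fun l : nat => refl l%:Z) u w.
Proof.
elim: w u => [|l w IH] u /=; last first.
  rewrite act_comp ?IH ?act_simple_refl //.
  by have [_ Pp _] := simple_refl_affine l n2.
by elim/evec_ind: u => [|a u v IHu IHv|j];
  rewrite ?linear0 ?linearP /= ?IHu ?IHv ?act_evec.
Qed.

Lemma sum_residue (F : int -> R) j :
  (forall i j, (i == j %[mod n%:Z])%Z -> F i = F j) ->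
  \sum_(i < n) congR i.+1%:Z j * F i.+1%:Z = F j.
Proof.
move=> Fmod; have [i [l jE]] := residueP j (ltnW n2).
rewrite (bigD1 i) //= big1 => [|k ki]; rewrite jE eqz_mod_residue.
  by rewrite eqxx mul1r addr0; apply: Fmod; rewrite eqz_mod_residue.
by rewrite (negbTE ki) mul0r.
Qed.

(** * The space [V], its complement and the projected vectors *)

Lemma sum_e_ord : sum_e R n = \sum_(i < n) e i.+1%:Z.
Proof. by rewrite /sum_e big_add1 big_mkord. Qed.

Lemma Kform_sum_e j : K (sum_e R n) (e j) = 1.
Proof.
rewrite KformC sum_e_ord linear_sum -[RHS](@sum_residue (fun=> 1) j) //=.
by apply: eq_bigr => i _; rewrite Kform_evec mulr1 eq_sym.
Qed.

Lemma Kform_sum_e_alpha i : K (sum_e R n) (al i) = 0.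
Proof. by rewrite linearB /= !Kform_sum_e subrr. Qed.

Lemma refl_sum_e i : refl i (sum_e R n) = sum_e R n.
Proof.
by rewrite /refl KformC Kform_sum_e_alpha scale0r subr0.
Qed.

Lemma alpha_Vspace j : al j \in Vspace R n.
Proof.
have [i [l ->]] := residueP j (ltnW n2); rewrite alpha_shift.
rewrite -(tnth_mktuple (fun i : 'I_n => al i.+1%:Z) i).
exact/memv_span/mem_tnth.
Qed.

Lemma refl_Vspace i u : u \in Vspace R n -> refl i u \in Vspace R n.
Proof. by move=> uV; rewrite rpredB ?rpredZ // alpha_Vspace. Qed.

Lemma alpha_nat (i : nat) : al i%:Z = e i.+1%:Z - e i%:Z.
Proof. by rewrite /alpha (_ : i%:Z + 1 = i.+1%:Z) //; lia. Qed.

Lemma delta_sum_alpha : de = \sum_(i < n) al i.+1%:Z.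
Proof.
rewrite deltaE -(big_mkord predT (fun i : nat => al i.+1%:Z)).
rewrite (@telescope_sumr_eq _ 0 n (fun i : nat => e i.+1%:Z)) //.
by move=> k _; exact: alpha_nat.
Qed.

Lemma Vspace_ind (P : 'rV[R]_n.+1 -> Prop) :
  P 0 -> (forall a u v, P u -> P v -> P (a *: u + v)) ->
  (forall j, P (al j)) ->
  forall u, u \in Vspace R n -> P u.
Proof.
move=> P0 PD Pal u /coord_span ->.
elim/big_rec: _ => // i v _ Pv; apply: PD => //.
by rewrite -tnth_nth tnth_mktuple.
Qed.

Lemma evecB_Vspace j k : e j - e k \in Vspace R n.
Proof.
have H i : e i - e 0 \in Vspace R n.
  elim/int_rect: i => [|i IH|i IH]; first by rewrite subrr mem0v.
    by rewrite -(subrK (e i%:Z) (e _)) -addrA rpredD // -alpha_nat alpha_Vspace.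
  have -> : e (- i.+1%:Z) - e 0 = (e (- i%:Z) - e 0) - al (- i.+1%:Z).
    rewrite /alpha (_ : - i.+1%:Z + 1 = - i%:Z); last by rewrite intS; ring.
    by rewrite opprB [RHS]addrC addrA subrK.
  by rewrite rpredB // alpha_Vspace.
have -> : e j - e k = (e j - e 0) - (e k - e 0) by rewrite opprB addrA subrK.
exact: rpredB.
Qed.

(** Pairing with [sum_e] under [K] vanishes on [V], but gives [n] on [sum_e] itself. *)
Lemma Vspace_sum_e : (Vspace R n :&: <[sum_e R n]>)%VS = 0%VS.
Proof.
apply/eqP; rewrite -subv0; apply/subvP => u; rewrite memv_cap memv0.
case/andP => uV /vlineP[a uE].
have : K (sum_e R n) u = 0.
  elim/Vspace_ind: uV {uE} => [|b v t Kv Kt|j]; first by rewrite linear0.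
    by rewrite linearP /= Kv Kt scaler0 addr0.
  exact: Kform_sum_e_alpha.
have K_sum_e t : K t (sum_e R n) = \sum_(i < n) K t (e i.+1%:Z).
  by rewrite sum_e_ord linear_sum.
rewrite uE linearZ /= K_sum_e (eq_bigr (fun=> 1)) => [|i _]; last first.
  exact: Kform_sum_e.
rewrite sumr_const card_ord => /eqP.
rewrite -[_ *: _]/(a * _) mulf_eq0 pnatr_eq0.
by case/orP => [/eqP ->|]; [rewrite scale0r | lia].
Qed.

Lemma evec_barE j : evec_bar R n j = e j - n%:R^-1 *: sum_e R n.
Proof.
have n0 : n%:R != 0 :> R by rewrite pnatr_eq0; lia.
have dV : e j - n%:R^-1 *: sum_e R n \in Vspace R n.
  (* The difference is the mean of the vectors [e j - e i] over a full period, each of which lies in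
     [V]. *)
  have -> : e j - n%:R^-1 *: sum_e R n =
      n%:R^-1 *: \sum_(i < n) (e j - e i.+1%:Z).
    rewrite sumrB -sum_e_ord sumr_const card_ord scalerBr -[e j *+ n]scaler_nat.
    by rewrite scalerA mulVf // scale1r.
  by apply/rpredZ/rpred_sum => i _; apply: evecB_Vspace.
(* The two projections of [sum_e] add up to it, and the one onto the line already returns all of
   it. *)
have s0 : daddv_pi (Vspace R n) <[sum_e R n]> (sum_e R n) = 0.
  apply: (addIr (daddv_pi <[sum_e R n]> (Vspace R n) (sum_e R n))).
  rewrite daddv_pi_add ?Vspace_sum_e ?(subvP (addvSr _ _)) ?memv_line //.
  by rewrite add0r daddv_pi_id ?memv_line // capvC Vspace_sum_e.
rewrite /evec_bar -{1}(subrK (n%:R^-1 *: sum_e R n) (e j)) linearD /=.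
rewrite daddv_pi_id ?Vspace_sum_e //.
have -> : daddv_pi (Vspace R n) <[sum_e R n]> (n%:R^-1 *: sum_e R n) = 0.
  by rewrite linearZ /= s0 scaler0.
by rewrite addr0.
Qed.

Lemma evec_barB i j : evec_bar R n i - evec_bar R n j = e i - e j.
Proof. by rewrite !evec_barE opprB addrA subrK. Qed.

Lemma evec_bar_Vspace j : evec_bar R n j \in Vspace R n.
Proof. exact: memv_pi. Qed.

Lemma act_evec_bar w j :
  act (word_prod n w) (evec_bar R n j) = evec_bar R n (word_prod n w j).
Proof.
have [_ Pp _] := word_prod_affine w n2.
rewrite !evec_barE linearB linearZ /= act_evec //; congr (_ - _ *: _).
by rewrite act_word; elim: w {Pp} => //= l w ->; rewrite refl_sum_e.
Qed.

Lemma sum_evec_bar : \sum_(i < n) evec_bar R n i.+1%:Z = 0.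
Proof.
under eq_bigr => i _ do rewrite evec_barE.
rewrite sumrB -sum_e_ord sumr_const card_ord.
rewrite -[_ *: _ *+ n]scaler_nat scalerA divff.
  by rewrite scale1r subrr.
by rewrite pnatr_eq0; lia.
Qed.

(** * The form omega and its invariance under the Coxeter element *)

Lemma omega_linear w u : linear (omega w u : 'rV[R]_n.+1 -> R^o).
Proof.
move=> a v t; rewrite /omega scaler_sumr -big_split; apply: eq_bigr => i _.
rewrite scaler_sumr -big_split; apply: eq_bigr => j _.
by rewrite linearP /GRing.scale /=; ring.
Qed.

HB.instance Definition _ w u :=
  GRing.isLinear.Build R 'rV[R]_n.+1 R^o *:%R (omega w u) (omega_linear w u).

Lemma omegaPl w a u v t :
  omega w (a *: u + v) t = a * omega w u t + omega w v t.
Proof.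
rewrite /omega mulr_sumr -big_split; apply: eq_bigr => i _.
rewrite mulr_sumr -big_split; apply: eq_bigr => j _.
by rewrite linearP /GRing.scale /=; ring.
Qed.

(** Simple roots, congruences and letter positions all depend on the index modulo [n], so the values
    on the basis determine those at all integers. *)
Lemma omega_alpha w i j : omega w (al i) (al j) = omega_simple R n w i j.
Proof.
have [i0 [l ->]] := residueP i (ltnW n2).
have [j0 [m ->]] := residueP j (ltnW n2).
rewrite !alpha_shift omega_simple_roots /omega_simple !alpha_shift.
rewrite [_ + l * _]addrC [_ + m * _]addrC !modzMDl.
rewrite /precedes (@eq_letter_pos n w (l * n + i0.+1%:Z) i0.+1%:Z) ?modzMDl //.
by rewrite (@eq_letter_pos n w (m * n + j0.+1%:Z) j0.+1%:Z) ?modzMDl.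
Qed.
Lemma Kform_alpha_alpha i : K (al i) (al i) = 2.
Proof.
have -> : K (al i) (al i) = K (al i) (e (i + 1)) - K (al i) (e i).
  by rewrite -linearB.
rewrite !Kform_alpha_evec !eqxx [(i == _ %[mod _])%Z]eq_sym !eqz_modS //.
by rewrite subr0 sub0r opprK.
Qed.

Lemma omega0l w u : omega w 0 u = 0.
Proof.
rewrite /omega big1 // => i _; rewrite big1 // => j _.
by rewrite linear0 !mul0r.
Qed.

Lemma omega_reflection (w : seq nat) (l : nat) u v :
  perm_eq (l :: w) (iota 1 n) -> u \in Vspace R n -> v \in Vspace R n ->
  omega (l :: w) (refl l%:Z u) (refl l%:Z v) = omega (rcons w l) u v.
Proof.
move=> wlP uV vV.
have wrP : perm_eq (rcons w l) (iota 1 n) by rewrite perm_rcons.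
have pll : letter_pos n (l :: w) l%:Z = 0%N.
  exact: (@letter_posE _ _ n2 wlP [::] w).
have prl : letter_pos n (rcons w l) l%:Z = size w.
  by rewrite (@letter_posE _ _ n2 wrP w [::]) // cats1.
have plk k : (l%:Z == k %[mod n%:Z])%Z = false ->
    letter_pos n (l :: w) k = (letter_pos n w k).+1.
  by rewrite /letter_pos /= => ->.
have prk k : (l%:Z == k %[mod n%:Z])%Z = false ->
    letter_pos n (rcons w l) k = letter_pos n w k /\
    (letter_pos n w k < size w)%N.
  move=> lk; have := has_letter_mod n2 wlP k.
  rewrite /= {1}/letter_mod lk /= => wk.
  by rewrite /letter_pos -cats1 find_cat wk; split=> //; rewrite -has_find.
elim/Vspace_ind: vV => [|a v1 t IHv IHt|j]; first by rewrite !linear0.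
  by rewrite !linearP /= IHv IHt.
elim/Vspace_ind: uV => [|a u1 t IHu IHt|i].
- by rewrite linear0 !omega0l.
- by rewrite linearP /= !omegaPl IHu IHt.
have B x y (s t : 'rV[R]_n.+1) a b : omega (l :: w) (x - a *: s) (y - b *: t) =
    omega (l :: w) x y - a * omega (l :: w) s y - b * omega (l :: w) x t
    + a * b * omega (l :: w) s t.
  have Bl z : omega (l :: w) (x - a *: s) z =
      omega (l :: w) x z - a * omega (l :: w) s z.
    by rewrite addrC -scaleNr omegaPl mulNr addrC.
  have Br z : omega (l :: w) z (y - b *: t) =
      omega (l :: w) z y - b * omega (l :: w) z t.
    by rewrite linearB linearZ.
  by rewrite Bl !Br; ring.
case li: (l%:Z == i %[mod n%:Z])%Z; case lj: (l%:Z == j %[mod n%:Z])%Z.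
- rewrite -(eq_alpha li) -(eq_alpha lj) /refl B !omega_alpha.
  rewrite /omega_simple !eqxx; ring.
(* With exactly one root equal to [al l], the sign in [refl l (al l) = - al l] makes up for the
   reversed order of [l] and the other letter. *)
- have [pj pjw] := prk j lj.
  rewrite -(eq_alpha li) /refl B !omega_alpha /omega_simple !eqxx lj /precedes.
  rewrite pll prl plk //= pj (ltnNge (size w)) (ltnW pjw).
  rewrite Kform_alpha_alpha; ring.
- have [pi piw] := prk i li.
  rewrite -(eq_alpha lj) /refl B !omega_alpha /omega_simple.
  rewrite !eqxx eq_sym li /precedes.
  rewrite pll prl plk //= pi piw Kform_alpha_alpha.
  rewrite !mulr0 subr0 addr0 -[2]/(1 + 1 : R) mulrDl mul1r.
  by rewrite opprD addrA subrr sub0r.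
(* With neither root equal to [al l], the order of [i] and [j] is the same in both words. As [l]
   comes first in [l :: w], the two correction terms linear in [al l] are opposite, and the
   quadratic one is zero. *)
have [pj pjw] := prk j lj; have [pi piw] := prk i li.
rewrite /refl B !omega_alpha /omega_simple !eqxx lj.
rewrite [(i == l %[mod _])%Z]eq_sym li.
rewrite /precedes pll pi pj !plk // ltnS ltn0Sn ltn0 [K (al i) (al l)]KformC.
by rewrite mulrN opprK [K (al l) (al j) * _]mulrC addrK mulr0 addr0.
Qed.

(** Each inductive step takes the last letter of [b], which acts first, and rotates it to the front
    of the word. Taking [a] empty gives the full rotation. *)
Lemma omega_word (a b : seq nat) u v :
  perm_eq (a ++ b) (iota 1 n) -> u \in Vspace R n -> v \in Vspace R n ->
  omega (b ++ a) (foldr (fun l : nat => refl l%:Z) u b)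
    (foldr (fun l : nat => refl l%:Z) v b) = omega (a ++ b) u v.
Proof.
elim/last_ind: b a u v => [|b l IH] a u v wP uV vV; first by rewrite cats0.
have wP' : perm_eq (l :: a ++ b) (iota 1 n) by rewrite -perm_rcons rcons_cat.
rewrite !foldr_rcons cat_rcons (IH (l :: a)) ?refl_Vspace //.
by rewrite omega_reflection // rcons_cat.
Qed.

Lemma omega_word_prod w u v :
  perm_eq w (iota 1 n) -> u \in Vspace R n -> v \in Vspace R n ->
  omega w (act (word_prod n w) u) (act (word_prod n w) v) = omega w u v.
Proof.
move=> wP uV vV; rewrite !act_word.
by have := @omega_word [::] w u v wP uV vV; rewrite cats0.
Qed.

(** * Values of omega on delta, and the effect of [c] on the gamma coordinate *)

Definition outer_sign w j : R := if outer n w j then 1 else - 1.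

Lemma eq_outer_sign w i j :
  (i == j %[mod n%:Z])%Z -> outer_sign w i = outer_sign w j.
Proof. by move=> ij; rewrite /outer_sign (eq_outer w ij). Qed.

(** Distinct simple roots pair nontrivially under [K] only at neighbouring residues. Keeping one
    term per neighbour covers [n = 2] as well, where [j - 1] and [j + 1] are congruent and both
    terms contribute. *)
Lemma omega_simpleE w i j : perm_eq w (iota 1 n) ->
  omega_simple R n w i j =
    congR i (j - 1) * outer_sign w j - congR i (j + 1) * outer_sign w i.
Proof.
move=> wP; have mod1 k : (k - 1 == k %[mod n%:Z])%Z = false.
  by rewrite -{2}[k](subrK 1) eq_sym eqz_modS.
have modB k k' : (k == k' - 1 %[mod n%:Z])%Z = (k + 1 == k' %[mod n%:Z])%Z.
  by rewrite -eqz_modSS subrK.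
rewrite /omega_simple; case: ifP => ij.
  have -> : (i == j - 1 %[mod n%:Z])%Z = false by rewrite (eqP ij) eq_sym mod1.
  have -> : (i == j + 1 %[mod n%:Z])%Z = false.
    by rewrite (eqP ij) eq_sym eqz_modS.
  by rewrite !mul0r subrr.
have -> : K (al i) (al j) = - congR i (j - 1) - congR i (j + 1).
  have -> : K (al i) (al j) = K (al i) (e (j + 1)) - K (al i) (e j).
    by rewrite -linearB.
  rewrite !Kform_alpha_evec // eqz_modSS [(j == i %[mod _])%Z]eq_sym ij.
  rewrite modB [(i + 1 == _ %[mod _])%Z]eq_sym [(i == j + 1 %[mod _])%Z]eq_sym.
  by rewrite sub0r subr0 addrC.
have P1 : (i == j - 1 %[mod n%:Z])%Z -> precedes n w i j = outer n w j.
  by move=> e1; rewrite /outer /precedes (eq_letter_pos w e1).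
have P2 : (i == j + 1 %[mod n%:Z])%Z -> precedes n w i j = ~~ outer n w i.
  move=> e1; have e2 : (i - 1 == j %[mod n%:Z])%Z by rewrite eq_sym modB eq_sym.
  rewrite -(precedesC n2 wP) ?mod1 // /precedes.
  by rewrite (eq_letter_pos w e2).
rewrite /outer_sign.
case e1: (i == j - 1 %[mod n%:Z])%Z; case e2: (i == j + 1 %[mod n%:Z])%Z.
- have := P2 e2; rewrite (P1 e1).
  by case: (outer n w j); case: (outer n w i) => //= _; ring.
- by rewrite (P1 e1); case: ifP => _ /=; ring.
- by rewrite (P2 e2); case: (outer n w i) => /=; ring.
- by case: ifP => _ /=; ring.
Qed.

(** Delta is the sum of all simple roots, and in that sum only the two neighbours of [j]
    contribute. *)
Lemma omega_delta_alpha w j : perm_eq w (iota 1 n) ->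
  omega w de (al j) = outer_sign w j - outer_sign w (j + 1).
Proof.
move=> wP; rewrite delta_sum_alpha.
have -> : omega w (\sum_(i < n) al i.+1%:Z) (al j) =
    \sum_(i < n) omega w (al i.+1%:Z) (al j).
  apply: (big_morph (omega w ^~ (al j))); last exact: omega0l.
  by move=> u v; rewrite -[u]scale1r omegaPl mul1r scale1r.
under eq_bigr => i _ do rewrite omega_alpha omega_simpleE //.
rewrite sumrB (@sum_residue (fun=> outer_sign w j)) //.
by rewrite (@sum_residue (outer_sign w)) //; apply: eq_outer_sign.
Qed.

Lemma omega_delta_evec_bar w : perm_eq w (iota 1 n) ->
  exists2 C : R, -1 < C < 1 &
    forall j, omega w de (evec_bar R n j) = C - outer_sign w j.
Proof.
move=> wP; pose y j := omega w de (evec_bar R n j).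
have yS j : y (j + 1) + outer_sign w (j + 1) = y j + outer_sign w j.
  have : y (j + 1) - y j = outer_sign w j - outer_sign w (j + 1).
    by rewrite -omega_delta_alpha // -linearB evec_barB.
  by lra.
have [C yC] : exists C, forall j, y j + outer_sign w j = C.
  exists (y 0 + outer_sign w 0) => j; elim/int_rect: j => [//|j <-|j <-].
    by rewrite intS (addrC 1); exact: yS.
  have := yS (- j.+1%:Z).
  by rewrite (_ : - j.+1%:Z + 1 = - j%:Z) => [<- //|]; rewrite intS; ring.
exists C; last by move=> j; rewrite -(yC j) addrK.
(* Summing [y i + outer_sign w i = C] over a period removes [y], since the projected vectors sum to
   zero. *)
have nC : n%:R * C = \sum_(i < n) outer_sign w i.+1%:Z.
  rewrite -[n in LHS]card_ord -sumr_const mulr_suml.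
  rewrite (eq_bigr (fun i : 'I_n => y i.+1%:Z + outer_sign w i.+1%:Z)).
    by rewrite big_split /= -linear_sum sum_evec_bar linear0 add0r.
  by move=> i _; rewrite mul1r yC.
have bnd j : -1 <= outer_sign w j <= 1 by rewrite /outer_sign; case: ifP; lra.
(* The bounds on the mean are strict because both signs occur: the outer residue [b] serves the
   lower bound, the inner residue [a] the upper one. *)
have [j0 [/negbTE inn out]] := exists_inner_outer n2 wP.
have [a [l aE]] := residueP j0 (ltnW n2).
have [b [m bE]] := residueP (j0 + 1) (ltnW n2).
have n0 : 0 < n%:R :> R by rewrite ltr0n; lia.
have sumE (x : R) : n%:R * x = \sum_(i < n) x.
  by rewrite sumr_const card_ord mulr_natl.
have lt_sum (F G : 'I_n -> R) (k : 'I_n) :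
    (forall i : 'I_n, F i <= G i) -> F k < G k ->
    \sum_(i < n) F i < \sum_(i < n) G i.
  move=> FG FGk; rewrite (bigD1 k) //= [ltRHS](bigD1 k) //=.
  by apply: ltr_leD => //; apply: ler_sum.
apply/andP; split; rewrite -(ltr_pM2l n0) nC sumE.
  apply: (lt_sum _ _ b) => [i|]; first by have /andP[] := bnd i.+1%:Z.
  rewrite (@eq_outer_sign w b.+1%:Z (j0 + 1)) ?bE ?eqz_mod_residue //.
  by rewrite -bE /outer_sign out; lra.
apply: (lt_sum _ _ a) => [i|]; first by have /andP[] := bnd i.+1%:Z.
rewrite (@eq_outer_sign w a.+1%:Z j0) ?aE ?eqz_mod_residue //.
by rewrite -aE /outer_sign inn; lra.
Qed.

Lemma omega_gamma w (c : int -> int) (g : 'rV[R]_n.+1) j :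
  coxeter_element n w c -> is_gamma c g ->
  omega w g (evec_bar R n (c j)) =
  omega w g (evec_bar R n j) - omega w de (evec_bar R n (c j)).
Proof.
move=> [_ wP cE] [gV cg].
have cact u : act c u = act (word_prod n w) u.
  by apply: eq_bigr => i _; rewrite cE.
have {}gV : g \in Vspace R n.
  apply: subvP gV; apply/span_subvP => _ /mapP[i _ ->]; exact: alpha_Vspace.
have := omega_word_prod wP gV (evec_bar_Vspace j).
rewrite act_evec_bar -cact cg -cE -[g + _]/(g + de).
rewrite -[g in g + _]scale1r omegaPl mul1r.
by move<-; rewrite addrK.
Qed.

End Linear.

(** * Monotonicity along each class, and the final assembly *)

Lemma consecutive_step_lt (R : numDomainType) (P : int -> bool)
    (f : int -> R) (d : R) :
  0 < d -> (forall j j', consecutive P j j' -> f j' - f j = d) ->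
  forall j j', j < j' -> P j -> P j' -> f j < f j'.
Proof.
move=> d0 fd j j'; have [m] := ubnP `|j' - j|%N.
elim: m j j' => // m IH j j' jm jj' Pj Pj'.
(* Since [j' - j] is at most [m], offsets below [m] reach every integer strictly between. A point of
   [P] found there splits the interval into two shorter ones; otherwise [j] and [j'] are
   consecutive. *)
case: (boolP [exists i : 'I_m, (0 < i)%N && (j + i%:Z < j') && P (j + i%:Z)]).
  case/existsP => i /andP[/andP[i0 ij'] Pi].
  by apply: (@lt_trans _ _ (f (j + i%:Z))); apply: IH => //; lia.
move=> /existsPn noP; rewrite -subr_gt0 (fd j j') //; split=> // k jk kj'.
have km : (`|k - j| < m)%N by lia.
have := noP (Ordinal km) => /=.
rewrite (_ : j + `|k - j|%N%:Z = k); last lia.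
by rewrite kj' (_ : (0 < `|k - j|)%N) //; lia.
Qed.

Theorem theorem3p11 (R : realType) (n : nat) (n_ge2 : (2 <= n)%N)
    (w : seq nat) (c : int -> int) (cox : coxeter_element n w c)
    (gamma : 'rV[R]_n.+1) (gammaP : is_gamma c gamma) :
  let y := fun j : int => omega w (delta R n) (evec_bar R n j) in
  let x := fun j : int => omega w gamma (evec_bar R n j) in
  (exists y_out y_inn : R,
    [/\ y_out < 0 /\ 0 < y_inn,
        forall j : int, outer n w j -> y j = y_out,
        forall j : int, inner n w j -> y j = y_inn,
        forall j j' : int, consecutive (outer n w) j j' -> x j' - x j = - y_out
      & forall j j' : int, consecutive (inner n w) j j' -> x j' - x j = y_inn])
  /\ (forall j j' : int, j < j' ->
        (outer n w j /\ outer n w j') \/ (inner n w j /\ inner n w j') ->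
        x j < x j')
  /\ (forall j : int, x (j + n%:Z) - x j = omega w gamma (delta R n)).
Proof.
move=> y x; have [_ wP cE] := cox.
have [C /andP[C1 C2] yE] := omega_delta_evec_bar R n_ge2 wP.
have out j : outer n w j -> y j = C - 1.
  by move=> oj; rewrite /y yE /outer_sign oj.
have inn j : inner n w j -> y j = C + 1.
  by move=> /negbTE oj; rewrite /y yE /outer_sign oj opprK.
have xc j : x (c j) = x j - y (c j) by exact: (omega_gamma n_ge2 j cox gammaP).
have xout j j' : consecutive (outer n w) j j' -> x j' - x j = - (C - 1).
  move=> jj'; have [_ _ oj' _] := jj'; have := xc j.
  rewrite cE (word_prod_outer n_ge2 wP jj') (out _ oj') => ->.
  by rewrite addrAC subrr add0r.
have xinn j j' : consecutive (inner n w) j j' -> x j' - x j = C + 1.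
  move=> jj'; have [_ ij _ _] := jj'; have := xc j'.
  (* Here [c] moves backwards, from [j'] to [j], so the increment is [y j] with a plus sign. *)
  rewrite cE (word_prod_inner n_ge2 wP jj') (inn _ ij) => ->.
  by rewrite opprB addrC subrK.
split; [exists (C - 1), (C + 1); split=> //; lra | split].
  move=> j j' jj' [] [tj tj'].
    by apply: (consecutive_step_lt _ xout) => //; lra.
  by apply: (consecutive_step_lt _ xinn) => //; lra.
(* Projection along [sum_e] preserves differences of the [e j], and [e (j + n) - e j] is delta. *)
move=> j; rewrite /x -linearB evec_barB //.
by rewrite -[n%:Z]mul1r evec_shift // addrC addKr scale1r.
Qed.
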